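(* For any maximal toral subalgebra $\mathfrak{t}\subseteq\mathfrak{sp}(V)$, we have $$\mathfrak{z}_{\mathfrak{sp}(V)}(\mathfrak{t})=\mathfrak{t}\oplus\mathrm{Sym}^2(V^0),$$ which is an abelian Lie algebra.
   Context: Everything is over $\mathbb{C}$. $V$ is a countably infinite-dimensional vector space with a nondegenerate antisymmetric bilinear form $\langle\cdot,\cdot\rangle$. $V\otimes V$ is an associative algebra with $(v\otimes w)\cdot(v'\otimes w')=\langle v',w\rangle\,v\otimes w'$, acting on $V$ by $(v\otimes w)\cdot u=\langle u,w\rangle v$; $\mathrm{Sym}^2(A)\subseteq A\otimes A$ is the span of $v\otimes w+w\otimes v$ with $v,w\in A$, and $\mathfrak{sp}(V)=\mathrm{Sym}^2(V)$ with the commutator bracket. $\mathfrak{sp}(V)$ is a union of nested finite-dimensional reductive subalgebras, each reductive in the next; an element is semisimple if it is semisimple in these (equivalently in all large enough ones), and a subalgebra is toral if all its elements are semisimple. $V^0:=\{m\in V:\exists\, i\in\mathbb{Z}_{>0}\text{ such that }x^i\cdot m=0\ \forall x\in\mathfrak{t}\}$ is the generalized zero weight space of $\mathfrak{t}$ in $V$. $\mathfrak{z}_{\mathfrak{sp}(V)}(\mathfrak{t})$ is the centralizer of $\mathfrak{t}$. *)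

(* Defs.v *)
From HB Require Import structures.
From mathcomp Require Import all_boot all_order all_algebra.
From mathcomp Require Import generic_quotient sesquilinear complex.
From mathcomp Require Import all_classical all_reals.

Set Implicit Arguments.
Unset Strict Implicit.
Unset Printing Implicit Defensive.
Import GRing.Theory.

Local Open Scope classical_set_scope.
Local Open Scope ring_scope.
Local Open Scope quotient_scope.

Declare Scope tensor_scope.
Open Scope tensor_scope.

Section Subspaces.
Variables (K : fieldType) (W : lmodType K).
Implicit Types (S U : set W).

Definition is_subspace U : Prop :=
  U 0 /\ forall (a : K) (x y : W), U x -> U y -> U (a *: x + y).

Definition lspan S : set W :=
  [set x | exists n (a : 'I_n -> K) (w : 'I_n -> W),
     (forall i, S (w i)) /\ x = \sum_(i < n) a i *: w i].

Definition finite_dim U : Prop := exists s : seq W, U = lspan [set` s].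

Definition direct_sum U U1 U2 : Prop :=
  U = [set x + y | x in U1 & y in U2] /\ U1 `&` U2 = [set 0].

Definition countably_infinite_dim : Prop :=
  exists e : nat -> W,
    (forall n (a : 'I_n -> K), \sum_(i < n) a i *: e i = 0 -> forall i, a i = 0)
    /\ lspan (range e) = setT.

End Subspaces.

Arguments countably_infinite_dim {K} W.

(* The tensor product is the set of formal sums u1 (x) v1 + ... + un (x) vn,  *)
(* encoded as lists of pairs, modulo the congruence generated by              *)
(* commutativity of the sum and bilinearity of (x). The opposite of a formal  *)
(* sum is obtained by negating the left factors.                              *)
Section TensorProduct.
Variables (K : fieldType) (U V : lmodType K).

Inductive tens_eqv : seq (U * V) -> seq (U * V) -> Prop :=
| TensRefl s : tens_eqv s s
| TensSym s t : tens_eqv s t -> tens_eqv t s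
| TensTrans s t r : tens_eqv s t -> tens_eqv t r -> tens_eqv s r
| TensCat s s' t t' :
    tens_eqv s s' -> tens_eqv t t' -> tens_eqv (s ++ t) (s' ++ t')
| TensCatC s t : tens_eqv (s ++ t) (t ++ s)
| Tens0 v : tens_eqv [:: (0, v)] [::]
| TensDl u u' v : tens_eqv [:: (u + u', v)] [:: (u, v); (u', v)]
| TensDr u v v' : tens_eqv [:: (u, v + v')] [:: (u, v); (u, v')]
| TensZ (a : K) u v : tens_eqv [:: (a *: u, v)] [:: (u, a *: v)].

Definition tens_rel : rel (seq (U * V)) := fun s t => `[< tens_eqv s t >].

Lemma tens_rel_refl : reflexive tens_rel.
Proof. by move=> s; apply/asboolP/TensRefl. Qed.

Lemma tens_rel_sym : symmetric tens_rel.
Proof. by move=> s t; apply/asboolP/asboolP => /TensSym. Qed.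

Lemma tens_rel_trans : transitive tens_rel.
Proof. by move=> t s r /asboolP st /asboolP tr; apply/asboolP/(TensTrans st tr). Qed.

Canonical tens_equiv := EquivRel tens_rel tens_rel_refl tens_rel_sym tens_rel_trans.

Definition tensor := {eq_quot tens_equiv}.
HB.instance Definition _ := Choice.on tensor.
HB.instance Definition _ := EqQuotient.on tensor.

Local Notation cls := (\pi_tensor : seq (U * V) -> tensor).

Lemma tens_piP s t : tens_eqv s t <-> cls s = cls t.
Proof.
split=> [st|/eqmodP/asboolP//]; by apply/eqmodP/asboolP.
Qed.

Lemma tens_reprK s : tens_eqv (repr (cls s)) s.
Proof. by apply/tens_piP; rewrite reprK. Qed.

Let scale_seq (a : K) (s : seq (U * V)) := [seq (a *: p.1, p.2) | p <- s].

Definition tens_add (x y : tensor) : tensor := cls (repr x ++ repr y).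
Definition tens_scale (a : K) (x : tensor) : tensor :=
  cls [seq (a *: p.1, p.2) | p <- repr x].
Definition tens_opp (x : tensor) : tensor := cls [seq (- p.1, p.2) | p <- repr x].

Lemma tens_addE s t : tens_add (cls s) (cls t) = cls (s ++ t).
Proof. by apply/tens_piP/TensCat; exact: tens_reprK. Qed.

Lemma scale_seq_eqv a s t : tens_eqv s t -> tens_eqv (scale_seq a s) (scale_seq a t).
Proof.
elim=> {s t}.
- by move=> s; exact: TensRefl.
- by move=> s t _; exact: TensSym.
- by move=> s t r _ st _; exact: TensTrans st.
- by move=> s s' t t' _ ss _ tt; rewrite /scale_seq !map_cat; exact: TensCat.
- by move=> s t; rewrite /scale_seq !map_cat; exact: TensCatC.
- by move=> v /=; rewrite scaler0; exact: Tens0.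
- by move=> u u' v /=; rewrite scalerDr; exact: TensDl.
- by move=> u v v' /=; exact: TensDr.
- by move=> b u v /=; rewrite scalerA mulrC -scalerA; exact: TensZ.
Qed.

Lemma tens_scaleE a s : tens_scale a (cls s) = cls (scale_seq a s).
Proof. by apply/tens_piP/scale_seq_eqv/tens_reprK. Qed.

Lemma tens_oppE x : tens_opp x = tens_scale (-1) x.
Proof. by congr (cls _); apply: eq_map => p; rewrite scaleN1r. Qed.

Lemma tens_addA : associative tens_add.
Proof.
elim/quotW=> s; elim/quotW=> t; elim/quotW=> r.
by rewrite (tens_addE t r) (tens_addE s t) (tens_addE s) (tens_addE _ r) catA.
Qed.

Lemma tens_addC : commutative tens_add.
Proof.
by elim/quotW=> s; elim/quotW=> t; rewrite !tens_addE; apply/tens_piP/TensCatC.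
Qed.

Lemma tens_add0 : left_id (cls [::]) tens_add.
Proof. by elim/quotW=> s; rewrite tens_addE. Qed.

Lemma tens_scaleDl_subproof x : {morph tens_scale^~ x : a b / a + b >-> tens_add a b}.
Proof.
elim/quotW: x => s a b; rewrite !tens_scaleE tens_addE; apply/tens_piP.
elim: s => [|[u v] s IH] /=; first exact: TensRefl.
apply: (@TensTrans _ ([:: (a *: u, v); (b *: u, v)] ++ (scale_seq a s ++ scale_seq b s))).
  rewrite -cat1s; apply: TensCat => //=; rewrite scalerDl; exact: TensDl.
rewrite /= -[X in tens_eqv X _]cat1s -[X in tens_eqv _ X]cat1s.
apply: TensCat; first exact: TensRefl.
rewrite -[X in tens_eqv X _]cat1s -[X in tens_eqv _ (_ ++ X)]cat1s !catA.
by apply: TensCat; [exact: TensCatC | exact: TensRefl].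
Qed.

Lemma tens_addN : left_inverse (cls [::]) tens_opp tens_add.
Proof.
move=> x; rewrite tens_oppE.
have x1 : tens_scale 1 x = x.
  elim/quotW: x => s; rewrite tens_scaleE; congr (cls _).
  by rewrite -[RHS]map_id; apply: eq_map => -[u v] /=; rewrite scale1r.
rewrite -[X in tens_add _ X]x1 -tens_scaleDl_subproof addNr.
elim/quotW: x {x1} => s; rewrite tens_scaleE; apply/tens_piP.
elim: s => [|[u v] s IH] /=; first exact: TensRefl.
rewrite -cat1s -[X in tens_eqv _ X]cat0s; apply: TensCat => //.
by rewrite scale0r; exact: Tens0.
Qed.

HB.instance Definition _ :=
  GRing.isZmodule.Build tensor tens_addA tens_addC tens_add0 tens_addN.

Lemma tens_scaleA a b x : tens_scale a (tens_scale b x) = tens_scale (a * b) x.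
Proof.
elim/quotW: x => s; rewrite (tens_scaleE b s) (tens_scaleE a) (tens_scaleE (a * b)).
rewrite /scale_seq -map_comp; congr (cls _).
by apply: eq_map => p /=; rewrite scalerA.
Qed.

Lemma tens_scale1 : left_id 1 tens_scale.
Proof.
elim/quotW=> s; rewrite tens_scaleE; congr (cls _).
by rewrite -[RHS]map_id; apply: eq_map => -[u v] /=; rewrite scale1r.
Qed.

Lemma tens_scaleDr : right_distributive tens_scale +%R.
Proof.
move=> a; elim/quotW=> s; elim/quotW=> t.
rewrite -[X in tens_scale _ X]/(tens_add _ _) (tens_addE s t) (tens_scaleE a (s ++ t)).
by rewrite (tens_scaleE a s) (tens_scaleE a t) -[RHS]/(tens_add _ _) tens_addE /scale_seq map_cat.
Qed.

Lemma tens_scaleDl x : {morph tens_scale^~ x : a b / a + b}.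
Proof. exact: tens_scaleDl_subproof. Qed.

HB.instance Definition _ := GRing.Zmodule_isLmodule.Build K tensor
  tens_scaleA tens_scale1 tens_scaleDr tens_scaleDl.

Definition tens (u : U) (v : V) : tensor := cls [:: (u, v)].

Lemma tensE s : cls s = \sum_(p <- s) tens p.1 p.2.
Proof.
elim: s => [|[u v] s IH]; first by rewrite big_nil.
by rewrite big_cons -IH -[RHS]/(tens_add _ _) tens_addE.
Qed.

Lemma tens_bilinear : bilinear_for *:%R *:%R tens.
Proof.
have aux a u v : tens (a *: u) v = a *: tens u v.
  by rewrite -[RHS]/(tens_scale _ _) tens_scaleE.
split=> [v a u u'|u a v v'] /=.
- rewrite -aux -[RHS]/(tens_add _ _) tens_addE; apply/tens_piP; exact: TensDl.
- have -> : a *: tens u v = tens u (a *: v) by rewrite -aux; apply/tens_piP/TensZ.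
  rewrite -[RHS]/(tens_add _ _) tens_addE; apply/tens_piP; exact: TensDr.
Qed.

HB.instance Definition _ :=
  bilinear_isBilinear.Build K U V tensor *:%R *:%R tens tens_bilinear.

Lemma tens_sum x : x = \sum_(p <- repr x) tens p.1 p.2.
Proof. by rewrite -tensE reprK. Qed.

(* The linear map induced by f; meaningful when f is bilinear. *)
Definition tlift (W : lmodType K) (f : U -> V -> W) (x : tensor) : W :=
  \sum_(p <- repr x) f p.1 p.2.

Lemma bilinear_forE (W : lmodType K) (f : U -> V -> W) :
  bilinear_for *:%R *:%R f ->
  [/\ (forall v, f 0 v = 0), (forall u u' v, f (u + u') v = f u v + f u' v),
      (forall u v v', f u (v + v') = f u v + f u v'),
      (forall a u v, f (a *: u) v = a *: f u v)
    & (forall a u v, f u (a *: v) = a *: f u v)].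
Proof.
case=> fl fr.
have f0 v : f 0 v = 0.
  by have := fl v (-1) 0 0; rewrite scaler0 addr0 /= scaleN1r addNr.
have f0r u : f u 0 = 0.
  by have := fr u (-1) 0 0; rewrite scaler0 addr0 /= scaleN1r addNr.
split=> //.
- by move=> u u' v; have := fl v 1 u u'; rewrite /= !scale1r.
- by move=> u v v'; have := fr u 1 v v'; rewrite /= !scale1r.
- by move=> a u v; have := fl v a u 0; rewrite /= f0 !addr0.
- by move=> a u v; have := fr u a v 0; rewrite /= f0r !addr0.
Qed.

Section Universal.
Variables (W : lmodType K) (f : U -> V -> W).
Hypothesis fB : bilinear_for *:%R *:%R f.

Lemma tlift_cls s : tlift f (cls s) = \sum_(p <- s) f p.1 p.2.
Proof.
have [f0 fD fDr fZ fZr] := bilinear_forE fB.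
suff eqvE s1 s2 : tens_eqv s1 s2 ->
    \sum_(p <- s1) f p.1 p.2 = \sum_(p <- s2) f p.1 p.2.
  exact: eqvE (tens_reprK s).
elim=> {s s1 s2} //.
- by move=> s t r _ -> _ ->.
- by move=> s s' t t' _ es _ et; rewrite !big_cat /= es et.
- by move=> s t; rewrite !big_cat /= addrC.
- by move=> v; rewrite big_seq1 big_nil f0.
- by move=> u u' v; rewrite big_seq1 big_cons big_seq1 /= fD.
- by move=> u v v'; rewrite big_seq1 big_cons big_seq1 /= fDr.
- by move=> a u v; rewrite !big_seq1 /= fZ fZr.
Qed.

Lemma tlift_tens u v : tlift f (tens u v) = f u v.
Proof. by rewrite tlift_cls big_seq1. Qed.

Lemma tlift_linear : linear (tlift f).
Proof.
have [_ _ _ fZ _] := bilinear_forE fB.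
move=> a; elim/quotW=> s; elim/quotW=> t.
rewrite -[X in tlift f X]/(tens_add (tens_scale _ _) _) tens_scaleE tens_addE.
rewrite !tlift_cls big_cat big_map /= scaler_sumr; congr (_ + _).
by apply: eq_bigr => p _; rewrite fZ.
Qed.

End Universal.

Lemma tens_ext (W : lmodType K) (g h : {linear tensor -> W}) :
  (forall u v, g (tens u v) = h (tens u v)) -> g =1 h.
Proof.
by move=> gh x; rewrite (tens_sum x) !linear_sum; apply: eq_bigr => p _.
Qed.

End TensorProduct.

Arguments tens_bilinear {K U V}.

Notation "U ⊗ V" := (tensor U V) (at level 40, left associativity) : type_scope.
Notation "u ⊗ v" := (tens u v) (at level 40, left associativity) : tensor_scope.

Section FormAlgebra.
Variables (K : fieldType) (V : lmodType K) (omega : {skew_symmetric V}).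

Definition form_nondegenerate : Prop :=
  forall u : V, (forall v : V, omega u v = 0) -> u = 0.

Definition tmul (x y : V ⊗ V) : V ⊗ V :=
  tlift (fun v w => tlift (fun v' w' => omega v' w *: (v ⊗ w')) y) x.

Definition tact (x : V ⊗ V) (u : V) : V :=
  tlift (fun v w => omega u w *: v) x.

Definition tbracket (x y : V ⊗ V) : V ⊗ V := tmul x y - tmul y x.

Let omega_l a u v w : omega (a *: u + v) w = a * omega u w + omega v w.
Proof. by rewrite linearPl. Qed.

Let omega_r a u v w : omega w (a *: u + v) = a * omega w u + omega w v.
Proof. by rewrite linearPr. Qed.

Lemma tact_bilinear_subproof u :
  bilinear_for *:%R *:%R (fun v w : V => omega u w *: v).
Proof.
split=> [w a v v'|v a w w'] /=.
- by rewrite scalerDr !scalerA mulrC.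
- by rewrite omega_r scalerDl scalerA.
Qed.

Lemma tact_tens v w u : tact (v ⊗ w) u = omega u w *: v.
Proof. exact: (tlift_tens (tact_bilinear_subproof u)). Qed.

Lemma tact_bilinear : bilinear_for *:%R *:%R tact.
Proof.
split=> [u a x y|x a u v] /=.
- exact: (tlift_linear (tact_bilinear_subproof u)).
- rewrite /tact /tlift scaler_sumr -big_split; apply: eq_bigr => p _ /=.
  by rewrite omega_l scalerDl scalerA.
Qed.

Lemma tmul_bilinear_inner (v w : V) :
  bilinear_for *:%R *:%R (fun v' w' : V => omega v' w *: (v ⊗ w')).
Proof.
split=> [w' a u u'|u a w1 w2] /=.
- by rewrite omega_l scalerDl scalerA.
- by rewrite linearPr scalerDr !scalerA mulrC.
Qed.

Lemma tmul_bilinear_outer (y : V ⊗ V) : bilinear_for *:%R *:%R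
  (fun v w : V => tlift (fun v' w' => omega v' w *: (v ⊗ w')) y).
Proof.
split=> [w a v v'|v a w w'] /=; rewrite /tlift scaler_sumr -big_split.
- by apply: eq_bigr => p _ /=; rewrite linearPl scalerDr !scalerA mulrC.
- by apply: eq_bigr => p _ /=; rewrite omega_r scalerDl scalerA.
Qed.

Lemma tmul_tens v w v' w' : tmul (v ⊗ w) (v' ⊗ w') = omega v' w *: (v ⊗ w').
Proof.
by rewrite /tmul (tlift_tens (tmul_bilinear_outer _)) (tlift_tens (tmul_bilinear_inner _ _)).
Qed.

Lemma tmul_bilinear : bilinear_for *:%R *:%R tmul.
Proof.
split=> [y a x x'|x a y y'] /=.
- exact: (tlift_linear (tmul_bilinear_outer y)).
- rewrite /tmul {1 3 5}/tlift scaler_sumr -big_split; apply: eq_bigr => p _ /=.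
  exact: (tlift_linear (tmul_bilinear_inner _ _)).
Qed.

HB.instance Definition _ :=
  bilinear_isBilinear.Build K (tensor V V) V V *:%R *:%R tact tact_bilinear.
HB.instance Definition _ :=
  bilinear_isBilinear.Build K (tensor V V) (tensor V V) (tensor V V) *:%R *:%R tmul tmul_bilinear.

Lemma tens_ind (P : V ⊗ V -> Prop) :
  (forall v w, P (v ⊗ w)) -> P 0 -> (forall x y, P x -> P y -> P (x + y)) ->
  forall x, P x.
Proof. by move=> Pt P0 PD x; rewrite (tens_sum x); apply: big_ind. Qed.

Lemma tmulA : associative tmul.
Proof.
have [m0 mDl mDr mZl mZr] := bilinear_forE tmul_bilinear.
have m0r x : tmul x 0 = 0 by rewrite -(scale0r 0) mZr !scale0r.
move=> x y z; elim/tens_ind: x => [v w||x x' IH IH']; last first.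
- by rewrite !mDl IH IH'.
- by rewrite !m0.
elim/tens_ind: y => [v' w'||y y' IH IH']; last first.
- by rewrite mDl !mDr mDl IH IH'.
- by rewrite m0 m0r m0.
elim/tens_ind: z => [v2 w2||z z' IH IH']; last first.
- by rewrite !mDr IH IH'.
- by rewrite !m0r.
by rewrite !tmul_tens mZl mZr !tmul_tens !scalerA mulrC.
Qed.

Lemma tact_tmul x y u : tact (tmul x y) u = tact x (tact y u).
Proof.
have [m0 mDl mDr mZl mZr] := bilinear_forE tmul_bilinear.
have m0r z : tmul z 0 = 0 by rewrite -(scale0r 0) mZr !scale0r.
have [a0 aDl aDr aZl aZr] := bilinear_forE tact_bilinear.
have a0r z : tact z 0 = 0 by rewrite -(scale0r 0) aZr !scale0r.
elim/tens_ind: x => [v w||x x' IH IH']; last first.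
- by rewrite mDl !aDl IH IH'.
- by rewrite m0 !a0.
elim/tens_ind: y => [v' w'||y y' IH IH']; last first.
- by rewrite mDr !aDl aDr IH IH'.
- by rewrite m0r !a0 a0r.
by rewrite tmul_tens aZl !tact_tens linearZl_LR /= scalerA mulrC.
Qed.

Definition Sym2 (A : set V) : set (V ⊗ V) :=
  lspan [set v ⊗ w + w ⊗ v | v in A & w in A].

Definition sp : set (V ⊗ V) := Sym2 setT.

End FormAlgebra.

Arguments sp {K} V.

(* Lie-theoretic notions, relative to a bracket on an ambient vector space *)
(* and to subspaces of it.                                                 *)
Section Lie.
Variables (K : fieldType) (L : lmodType K) (br : L -> L -> L).
Implicit Types (g h t : set L).

Definition lie_subalgebra h : Prop :=
  is_subspace h /\ forall x y, h x -> h y -> h (br x y).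

Definition abelian_on h : Prop := forall x y, h x -> h y -> br x y = 0.

Definition centralizer g t : set L :=
  [set x | g x /\ forall y, t y -> br x y = 0].

Definition ad_submodule h (U : set L) : Prop :=
  is_subspace U /\ forall x u, h x -> U u -> U (br x u).

(* g is a semisimple (completely reducible) module under ad h. *)
Definition reductive_in h g : Prop :=
  forall U, ad_submodule h U -> U `<=` g ->
  exists W, [/\ ad_submodule h W, W `<=` g & direct_sum g U W].

Definition reductive g : Prop := reductive_in g g.

(* ad x is diagonalizable on g, which for finite-dimensional g over an *)
(* algebraically closed field means that it is a semisimple operator.  *)
Definition semisimple_in g (x : L) : Prop :=
  g `<=` lspan [set z | g z /\ exists a : K, br x z = a *: z].

Definition reductive_exhaustion g (G : nat -> set L) : Prop :=
  [/\ forall n, [/\ lie_subalgebra (G n), finite_dim (G n) & reductive (G n)],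
      forall n, G n `<=` G n.+1,
      forall n, reductive_in (G n) (G n.+1)
    & \bigcup_n G n = g].

Definition semisimple (G : nat -> set L) (x : L) : Prop :=
  forall n, G n x -> semisimple_in (G n) x.

Definition toral g G t : Prop :=
  [/\ lie_subalgebra t, t `<=` g & forall x, t x -> semisimple G x].

Definition maximal_toral g G t : Prop :=
  toral g G t /\ forall t', toral g G t' -> t `<=` t' -> t' = t.

End Lie.

Definition generalized_zero_space (K : fieldType) (V : lmodType K)
    (omega : {skew_symmetric V}) (t : set (V ⊗ V)) : set V :=
  [set m | exists i, (0 < i)%N /\
     forall x, t x -> iter i (tact omega x) m = 0].

(* Main.v *)
Require Import Defs.
From mathcomp Require Import all_boot all_order all_algebra.
From mathcomp Require Import generic_quotient sesquilinear complex.
From mathcomp Require Import all_classical all_reals.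

(* Since some nonzero z in V is killed by x in sp(V), the map y |-> y z makes *)
(* V a quotient of the adjoint module; hence x is semisimple, for any         *)
(* exhaustion, if and only if it is diagonalizable on V.                      *)
(* If v and w are t-eigenvectors and omega v w != 0, then v (x) w + w (x) v is *)
(* diagonalizable and commutes with t, so it lies in t by maximality. For v   *)
(* and w in V^0 this is absurd, so V^0 is isotropic. For x in the centralizer *)
(* that does not kill t V, such a hyperbolic pair can be found among the      *)
(* eigenvectors of x, and subtracting a multiple of its element of t lowers   *)
(* the rank of x. By induction x is the sum of an element of t and of some n  *)
(* with n t V = 0; then n maps V into V^0, that is, n lies in Sym2(V^0).      *)

Set Implicit Arguments.
Unset Strict Implicit.
Unset Printing Implicit Defensive.
Import GRing.Theory Num.Theory.

Local Open Scope classical_set_scope.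
Local Open Scope ring_scope.

(** Elements of sp(V) have finite rank on V, and [semisimpleP] replaces semisimplicity relative to
    the exhaustion by diagonalizability on V. Then [toral_abelian] and [maximal_toral_mem] turn
    maximality into a membership test for [t], which [hyperbolic_mem] applies to hyperbolic pairs.
    From this come [null_space_isotropic] and [centralizer_reduction]; what the latter leaves over
    is placed in Sym2(V^0) by [Sym2_range], which only looks at its image. The sum is direct because
    a common element of [t] and Sym2(V^0) squares to zero on V yet is diagonalizable. The
    centralizer is abelian because [t] is abelian and kills V^0, and because products in Sym2(V^0)
    vanish when V^0 is isotropic. *)

Section Subspaces.
Variables (K : fieldType) (W : lmodType K).
Implicit Types (S U : set W) (f : W -> W).

(** * Subspaces and linear spans *)

Lemma subspaceZ U a x : is_subspace U -> U x -> U (a *: x).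
Proof. by case=> U0 UP Ux; rewrite -[_ *: _]addr0; exact: UP. Qed.

Lemma subspaceD U x y : is_subspace U -> U x -> U y -> U (x + y).
Proof. by case=> U0 UP Ux Uy; rewrite -[x]scale1r; exact: UP. Qed.

Lemma subspaceB U x y : is_subspace U -> U x -> U y -> U (x - y).
Proof.
by move=> sU Ux Uy; apply: subspaceD => //; rewrite -scaleN1r; exact: subspaceZ.
Qed.

Lemma subspace_sum U (I : Type) (r : seq I) (P : pred I) (F : I -> W) :
  is_subspace U -> (forall i, P i -> U (F i)) -> U (\sum_(i <- r | P i) F i).
Proof.
by move=> sU UF; apply: big_ind => //; [case: sU | move=> *; exact: subspaceD].
Qed.

Lemma subspace_setT : is_subspace [set: W].
Proof. by []. Qed.

Lemma lspan_subspace S : is_subspace (lspan S).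
Proof.
split; first by exists 0%N, (fun=> 0), (fun=> 0); split; [case | rewrite big_ord0].
move=> a x y [n [b [v [Sv ->]]]] [m [c [w [Sw ->]]]].
exists (n + m)%N,
  (fun i => match fintype.split i with inl j => a * b j | inr j => c j end),
  (fun i => match fintype.split i with inl j => v j | inr j => w j end); split.
  by move=> i; case: (fintype.split i).
rewrite big_split_ord scaler_sumr /=; congr (_ + _); apply: eq_bigr => i _.
  by rewrite -[lshift _ _]/(unsplit (inl i)) unsplitK scalerA.
by rewrite -[rshift _ _]/(unsplit (inr i)) unsplitK.
Qed.

Lemma sub_lspan S : S `<=` lspan S.
Proof.
move=> x Sx; exists 1%N, (fun=> 1), (fun=> x); split=> //.
by rewrite big_ord1 scale1r.
Qed.

Lemma lspan_sub S U : is_subspace U -> S `<=` U -> lspan S `<=` U.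
Proof.
move=> sU SU _ [n [a [w [Sw ->]]]]; apply: subspace_sum => // i _.
by apply: subspaceZ => //; exact: SU.
Qed.

(** * Eigenvector decompositions in arbitrary dimension *)

Definition eigenvectors f : set W := [set u | exists a, f u = a *: u].

Section Linear.
Variable f : W -> W.
Hypothesis f_linear : linear f.

Lemma lin_scale a x : f (a *: x) = a *: f x.
Proof. exact: (scalable_linear f_linear). Qed.

Lemma lin0 : f 0 = 0.
Proof. by have := lin_scale 0 0; rewrite !scale0r. Qed.

Lemma lin_sum (I : Type) (r : seq I) (F : I -> W) :
  f (\sum_(i <- r) F i) = \sum_(i <- r) f (F i).
Proof.
by apply: (big_morph f _ lin0) => x y; rewrite -[x]scale1r f_linear !scale1r.
Qed.

(** Applying [f] minus [b] kills the component at [b] and multiplies every other one by [a - b],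
    which is nonzero as [s] has no duplicates. Induction on [s] puts these in [U]; the component at
    [b] is the remainder. *)
Lemma distinct_eigen_component U (s : seq K) (g : K -> W) :
  is_subspace U -> (forall u, U u -> U (f u)) -> uniq s ->
  (forall a, f (g a) = a *: g a) ->
  U (\sum_(a <- s) g a) -> forall a, a \in s -> U (g a).
Proof.
move=> sU fU + geig; elim: s g geig => [|b s IH] g geig //= /andP[bs us].
rewrite big_cons => Us.
have gs a : a \in s -> U (g a).
  move=> sa; suff /(subspaceZ (a - b)^-1 sU) : U ((a - b) *: g a).
    rewrite scalerA mulVf ?scale1r // subr_eq0.
    by apply: contraNneq bs => <-.
  apply: (IH (fun a => (a - b) *: g a)) sa => // [c|].
    by rewrite lin_scale geig !scalerA mulrC.
  have := subspaceB sU (fU _ Us) (subspaceZ b sU Us).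
  rewrite -[g b]scale1r f_linear lin_sum geig !scale1r scalerDr.
  rewrite opprD addrACA subrr add0r scaler_sumr -sumrB.
  by under eq_bigr do rewrite geig -scalerBl.
move=> a; rewrite inE => /orP[/eqP->|/gs//].
have := subspaceB sU Us (subspace_sum s sU gs).
by rewrite -big_seq addrK.
Qed.

(** Collecting terms with equal eigenvalue makes the eigenvalues distinct, so an invariant subspace
    containing [u] contains every component: diagonalizability passes to invariant subspaces. *)
Lemma eigen_decomposition U u :
  is_subspace U -> (forall v, U v -> U (f v)) -> U u ->
  lspan (eigenvectors f) u ->
  exists (s : seq K) (g : K -> W), [/\ uniq s, u = \sum_(a <- s) g a,
    forall a, f (g a) = a *: g a & forall a, a \in s -> U (g a)].
Proof.
move=> sU fU Uu [n [b [w [ew uE]]]].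
have /boolp.choice[c cE] i : exists c, f (w i) = c *: w i by exact: ew.
pose s := undup (codom c).
pose g a := \sum_(i < n | c i == a) b i *: w i.
have geig a : f (g a) = a *: g a.
  rewrite /g big_mkcond lin_sum scaler_sumr; apply: eq_bigr => i _.
  case: eqP => [<-|_]; last by rewrite lin0 scaler0.
  by rewrite lin_scale cE !scalerA mulrC.
have us : uniq s by exact: undup_uniq.
have usum : u = \sum_(a <- s) g a.
  rewrite uE /g (exchange_big_dep predT) //=; apply: eq_bigr => i _.
  rewrite big_mkcond (bigD1_seq (c i)) ?mem_undup ?codom_f //=.
  by rewrite eqxx big1 ?addr0 // => a /negPf aci; rewrite eq_sym aci.
exists s, g; split=> //.
by apply: distinct_eigen_component => //; rewrite -usum.
Qed.

(** The components of [f (f u)] are those of [u] scaled by [a * a]. They vanish separately, so each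
    component is zero or has eigenvalue zero. *)
Lemma eigen_nilpotent u : lspan (eigenvectors f) u -> f (f u) = 0 -> f u = 0.
Proof.
move=> /(eigen_decomposition subspace_setT (fun _ _ => I) I).
move=> [s [g [us -> geig _]]].
have E : f (f (\sum_(a <- s) g a)) = \sum_(a <- s) (a * a) *: g a.
  by rewrite !lin_sum; apply: eq_bigr => a _; rewrite geig lin_scale geig scalerA.
rewrite {}E => E0; rewrite lin_sum big_seq big1 // => a sa; rewrite geig.
have : (a * a) *: g a = 0.
  apply: (@distinct_eigen_component [set 0] s (fun a => (a * a) *: g a)) => //.
  - by split=> // c x y -> ->; rewrite scaler0 addr0.
  - by move=> _ ->; exact: lin0.
  - by move=> c; rewrite lin_scale geig !scalerA mulrC.
move/eqP; rewrite scaler_eq0 mulf_eq0 orbb => /orP[/eqP->|/eqP->].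
  by rewrite scale0r.
by rewrite scaler0.
Qed.

End Linear.

(** * Dimension bounds *)

(** Bounding dimension by linear dependence avoids choosing a basis of a subspace of the
    infinite-dimensional V. *)
Definition dim_le U n : Prop :=
  forall w : 'I_n.+1 -> W, (forall i, U (w i)) ->
  exists2 c : 'rV[K]_n.+1, c != 0 & \sum_i c 0 i *: w i = 0.

Lemma dim_le_comb U n (e : 'I_n -> W) :
  (forall u, U u -> exists c : 'I_n -> K, u = \sum_i c i *: e i) -> dim_le U n.
Proof.
move=> Ue w Uw.
have /boolp.choice[M ME] i := Ue _ (Uw i).
pose A := \matrix_(i < n.+1, j < n) M i j.
have : kermx A != 0.
  rewrite kermx_eq0 /row_free neq_ltn; apply/orP; left.
  by rewrite ltnS rank_leq_col.
move=> /rowV0Pn[c /sub_kermxP cA c0]; exists c => //.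
under eq_bigr => i _ do rewrite ME scaler_sumr.
rewrite exchange_big big1 //= => j _.
under eq_bigr do rewrite scalerA.
rewrite -scaler_suml.
have /rowP/(_ j) := cA; rewrite !mxE => cAj.
rewrite (_ : \sum_i _ = 0) ?scale0r // -[RHS]cAj.
by apply: eq_bigr => i _; rewrite mxE.
Qed.

Lemma dim_le0 U u : dim_le U 0 -> U u -> u = 0.
Proof.
move=> U0 Uu; have [c c0] := U0 (fun=> u) (fun=> Uu).
rewrite big_ord1 => /eqP; rewrite scaler_eq0 => /orP[/eqP E|/eqP//].
by case/eqP: c0; apply/rowP => i; rewrite ord1 E mxE.
Qed.

(** In a relation between [u] and vectors of [U'], the coefficient of [u] must vanish since [u] is
    outside [U']. This drives both inductions on dimension below. *)
Lemma dim_le_proper U U' n u : is_subspace U' -> U' `<=` U -> dim_le U n.+1 ->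
  U u -> ~ U' u -> dim_le U' n.
Proof.
move=> sU' U'U Un Uu nU'u w U'w.
pose w' i := oapp w u (unlift (@ord0 n.+1) i).
have [c c0] : exists2 c : 'rV[K]_n.+2, c != 0 & \sum_i c 0 i *: w' i = 0.
  by apply: Un => i; rewrite /w'; case: unliftP => //= j _; exact: U'U.
rewrite big_ord_recl {1}/w' unlift_none /=.
under eq_bigr do rewrite /w' liftK /=.
move=> E; have c00 : c 0 0 = 0.
  apply: contrapT => /eqP c00; apply: nU'u.
  have -> : u = - (c 0 0)^-1 *: \sum_(i < n.+1) c 0 (lift 0 i) *: w i.
    apply: (scalerI c00); rewrite scalerA mulrN mulfV // scaleN1r.
    by apply/eqP; rewrite -addr_eq0 E.
  apply: subspaceZ => //; apply: subspace_sum => // i _.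
  exact: subspaceZ.
exists (\row_i c 0 (lift 0 i)); last first.
  rewrite c00 scale0r add0r in E.
  by rewrite -[RHS]E; apply: eq_bigr => i _; rewrite mxE.
apply: contraNneq c0 => /rowP c'0; apply/eqP/rowP => i; rewrite mxE.
by case: (unliftP 0 i) => [j ->|-> //]; have := c'0 j; rewrite !mxE.
Qed.

End Subspaces.

(** * The symplectic form and the action of sp(V) on V and on tensors *)

Section Symplectic.
Variables (K : fieldType) (V : lmodType K) (omega : {skew_symmetric V}).
Hypothesis two_neq0 : 2%:R != 0 :> K.
Hypothesis omega_nondeg : form_nondegenerate omega.
Implicit Types (x y : V ⊗ V) (A B : set V).

Local Notation act := (tact omega).
Local Notation br := (tbracket omega).

Lemma omega_skew u v : omega u v = - omega v u.
Proof. by rewrite [LHS]hermC /= expr1 mulN1r. Qed.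

Lemma omega_alt v : omega v v = 0.
Proof.
apply/eqP; move/eqP: (omega_skew v v).
by rewrite -subr_eq0 opprK -mulr2n -mulr_natl mulf_eq0 (negPf two_neq0).
Qed.

Lemma omega_dual v : v != 0 -> exists u, omega u v = 1.
Proof.
move=> v0; have [w vw] : exists w, omega v w != 0.
  apply: contrapT => nw; case/eqP: v0; apply: omega_nondeg => w.
  by apply: contrapT => /eqP vw; apply: nw; exists w.
exists (- (omega v w)^-1 *: w).
by rewrite linearZl_LR /= (omega_skew w) mulrN mulNr opprK mulVf.
Qed.

Lemma act_linear x : linear (act x).
Proof. exact: (tact_bilinear omega).2. Qed.

Lemma br_linear x : linear (br x).
Proof.
move=> a y z; rewrite /tbracket linearPr linearPl scalerBr /=.
by rewrite opprD addrACA.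
Qed.

Lemma brC x y : br x y = - br y x.
Proof. by rewrite /tbracket opprB. Qed.

Lemma brxx x : br x x = 0.
Proof. exact: subrr. Qed.

Lemma br_linear_l y : linear (br^~ y).
Proof. by move=> a x x'; rewrite /= !(brC _ y) br_linear opprD scalerN. Qed.

Lemma act_br x y u : act (br x y) u = act x (act y u) - act y (act x u).
Proof. by rewrite linearBl /= !tact_tmul. Qed.

Lemma act_comm x y u : br x y = 0 -> act x (act y u) = act y (act x u).
Proof.
by move=> xy; apply/eqP; rewrite -subr_eq0 -act_br xy linear0l.
Qed.

Lemma Sym2_subspace A : is_subspace (Sym2 A).
Proof. exact: lspan_subspace. Qed.

Lemma Sym2_tens A v w : A v -> A w -> Sym2 A (v ⊗ w + w ⊗ v).
Proof. by move=> Av Aw; apply: sub_lspan; exists v => //; exists w. Qed.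

Lemma Sym2_ind A (P : V ⊗ V -> Prop) : P 0 ->
  (forall a x y, P x -> P y -> P (a *: x + y)) ->
  (forall v w, A v -> A w -> P (v ⊗ w + w ⊗ v)) -> forall x, Sym2 A x -> P x.
Proof.
move=> P0 PP Pt; apply: lspan_sub; first by split.
by move=> _ [v Av [w Aw <-]]; exact: Pt.
Qed.

Lemma Sym2_sp A : Sym2 A `<=` sp V.
Proof.
apply: Sym2_ind; first by case: (Sym2_subspace setT).
  by case: (Sym2_subspace setT).
by move=> v w _ _; exact: Sym2_tens.
Qed.

Lemma act_sym v w u : act (v ⊗ w + w ⊗ v) u = omega u w *: v + omega u v *: w.
Proof. by rewrite linearDl /= !tact_tens. Qed.

Lemma act_skew x u w : sp V x -> omega (act x u) w = - omega u (act x w).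
Proof.
move: x; apply: Sym2_ind => [|a x y IHx IHy|v v' _ _].
- by rewrite !linear0l linear0r oppr0.
- rewrite linearPl /= [LHS]linearPl /= IHx IHy linearPl /= linearPr /=.
  by rewrite opprD mulrN.
rewrite !act_sym linearPl linearPr /= linearZl_LR linearZr_LR /=.
rewrite (omega_skew w v') (omega_skew w v) !mulNr -opprD opprK.
by rewrite addrC [_ * omega v w]mulrC [_ * omega v' w]mulrC.
Qed.

Lemma tmul_tensr x v w : tmul omega x (v ⊗ w) = act x v ⊗ w.
Proof.
elim/tens_ind: x => [a b||x y IHx IHy].
- by rewrite tmul_tens tact_tens linearZl_LR.
- by rewrite !linear0l.
- by rewrite !linearDl /= IHx IHy.
Qed.

Lemma tmul_tensl x v w : sp V x -> tmul omega (v ⊗ w) x = - (v ⊗ act x w).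
Proof.
move: x; apply: Sym2_ind => [|a x y IHx IHy|a b _ _].
- by rewrite linear0r linear0l linear0r oppr0.
- by rewrite linearPr linearPl linearPr /= IHx IHy opprD scalerN.
rewrite linearDr /= !tmul_tens act_sym linearDr /= !linearZr_LR /=.
by rewrite (omega_skew w) (omega_skew w a) !scaleNr opprD !opprK addrC.
Qed.

(** Right multiplication by [x] is minus the action of [x] on the second factor, so the adjoint
    action is the tensor square of the action on V, and eigenvalues add. *)
Lemma br_tens x v w : sp V x -> br x (v ⊗ w) = act x v ⊗ w + v ⊗ act x w.
Proof. by move=> spx; rewrite /tbracket tmul_tensr tmul_tensl // opprK. Qed.

Lemma br_eigen x v w a b : sp V x -> act x v = a *: v -> act x w = b *: w ->
  br x (v ⊗ w) = (a + b) *: (v ⊗ w).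
Proof.
by move=> spx va wb; rewrite br_tens // va wb linearZl_LR linearZr_LR scalerDl.
Qed.

(** * Recognizing Sym2(A) by the image; finite rank *)

Definition tswap x : V ⊗ V := tlift (fun v w => w ⊗ v) x.

Lemma swap_bilinear : bilinear_for *:%R *:%R (fun v w : V => w ⊗ v).
Proof.
split=> [w a u v|w a u v] /=; first by rewrite linearPr.
by rewrite linearPl.
Qed.

Lemma tswap_linear : linear tswap.
Proof. exact: tlift_linear swap_bilinear. Qed.

Lemma tswap_tens v w : tswap (v ⊗ w) = w ⊗ v.
Proof. exact: (tlift_tens swap_bilinear). Qed.

Lemma tswap_sp x : sp V x -> tswap x = x.
Proof.
move: x; apply: Sym2_ind => [|a x y IHx IHy|v w _ _].
- exact: (lin0 tswap_linear).
- by rewrite tswap_linear IHx IHy.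
rewrite -[v ⊗ w]scale1r tswap_linear !tswap_tens scale1r addrC.
by rewrite scale1r.
Qed.

Lemma act_sum (s : seq (V * V)) u :
  act (\sum_(r <- s) r.1 ⊗ r.2) u = \sum_(r <- s) omega u r.2 *: r.1.
Proof.
by rewrite linear_sumlz; apply: eq_bigr => r _; rewrite /= tact_tens.
Qed.

(* Gaussian elimination: pairing with a vector dual to the second factor of   *)
(* the first summand replaces the first factor by an element of A.            *)
Lemma tensor_range A B (s : seq (V * V)) : is_subspace A -> is_subspace B ->
  (forall r, r \in s -> B r.2) ->
  (forall u, A (act (\sum_(r <- s) r.1 ⊗ r.2) u)) ->
  exists2 s' : seq (V * V), forall r, r \in s' -> A r.1 /\ B r.2 &
    \sum_(r <- s) r.1 ⊗ r.2 = \sum_(r <- s') r.1 ⊗ r.2.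
Proof.
move=> sA sB; have [n] := ubnP (size s).
elim: n s => // n IH [|[p q] s] /= lt_sn Bs As.
  by exists [::].
have {}Bq : B q by apply: (Bs (p, q)); rewrite inE eqxx.
have {}Bs r : r \in s -> B r.2 by move=> rs; apply: Bs; rewrite inE rs orbT.
have [q0|/omega_dual[u uq]] := eqVneq q 0.
  rewrite big_cons /= q0 linear0r add0r; apply: IH => // u.
  by move: (As u); rewrite big_cons /= q0 linear0r add0r.
pose x := \sum_(r <- (p, q) :: s) r.1 ⊗ r.2.
pose s1 := [seq (r.1, r.2 - omega u r.2 *: q) | r <- s].
have xE : x = act x u ⊗ q + \sum_(r <- s1) r.1 ⊗ r.2.
  rewrite /x act_sum !big_cons /= uq scale1r linearDl /= -addrA; congr (_ + _).
  rewrite linear_sumlz big_map -big_split; apply: eq_bigr => r _ /=.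
  by rewrite linearBr /= linearZl_LR linearZr_LR /= addrC subrK.
have [|||s' As' s'E] := IH s1.
- by rewrite size_map.
- move=> _ /mapP[r rs ->] /=; apply: subspaceB => //; first exact: Bs.
  exact: subspaceZ.
- move=> w; have -> : \sum_(r <- s1) r.1 ⊗ r.2 = x - act x u ⊗ q.
    by rewrite [X in X - _]xE addrAC subrr add0r.
  rewrite linearBl /= tact_tens; apply: subspaceB => //.
  exact: subspaceZ.
exists ((act x u, q) :: s').
  by move=> r; rewrite inE => /orP[/eqP->|/As'//]; split=> //; exact: As.
by rewrite [RHS]big_cons /= -s'E; exact: xE.
Qed.

(** [tensor_range] brings the left factors into [A]. The swap fixes [x], so a second application to
    the swapped sum brings both factors into [A]; averaging with the swapped sum gives a symmetric
    expression. *)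
Lemma Sym2_range A x : is_subspace A -> sp V x -> (forall u, A (act x u)) ->
  Sym2 A x.
Proof.
move=> sA spx Ax.
have [||s As xE] := @tensor_range A setT (repr x) sA (@subspace_setT _ _) => //.
  by move=> u; rewrite -tens_sum.
rewrite -tens_sum in xE.
have swapE (r : seq (V * V)) : tswap (\sum_(i <- r) i.1 ⊗ i.2) =
    \sum_(i <- [seq (i.2, i.1) | i <- r]) i.1 ⊗ i.2.
  rewrite (lin_sum tswap_linear) big_map.
  by apply: eq_bigr => i _; rewrite tswap_tens.
have xE' := tswap_sp spx; rewrite xE swapE -xE in xE'.
have [||s' As' xs'] := @tensor_range A A [seq (i.2, i.1) | i <- s] sA sA => //.
- by move=> _ /mapP[i is_ ->]; case: (As _ is_).
- by move=> u; rewrite xE'.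
rewrite xE' in xs'.
have -> : x = 2%:R^-1 *: \sum_(r <- s') (r.1 ⊗ r.2 + r.2 ⊗ r.1).
  apply: (scalerI two_neq0); rewrite scalerA mulfV // scale1r big_split /= -xs'.
  have <- : tswap x = \sum_(r <- s') r.2 ⊗ r.1 by rewrite {1}xs' swapE big_map.
  by rewrite tswap_sp // scaler_nat mulr2n.
have sS := Sym2_subspace A; apply: subspaceZ => //.
rewrite big_seq; apply: subspace_sum => // r /As'[A1 A2]; exact: Sym2_tens.
Qed.

Lemma act_faithful x : sp V x -> (forall u, act x u = 0) -> x = 0.
Proof.
move=> spx x0; have /Sym2_range /(_ spx x0) : is_subspace [set 0 : V].
  by split=> // a u v -> ->; rewrite scaler0 addr0.
move: (x); apply: Sym2_ind => // [a y z -> ->|_ _ -> ->].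
  by rewrite scaler0 addr0.
by rewrite linear0l addr0.
Qed.

Lemma act_dim_le x : exists n, dim_le (range (act x)) n.
Proof.
exists (size (repr x)).
apply: (dim_le_comb (e := fun i => (tnth (in_tuple (repr x)) i).1)).
move=> _ [u _ <-]; exists (fun i => omega u (tnth (in_tuple (repr x)) i).2).
by rewrite {1}(tens_sum x) act_sum big_tnth.
Qed.

(** The images of more independent vectors than the rank of [x] satisfy a nontrivial relation. This
    is where V has to be infinite-dimensional. *)
Lemma act_kernel x : countably_infinite_dim V -> exists2 z, z != 0 & act x z = 0.
Proof.
move=> [e [free_e _]]; have [n xn] := act_dim_le x.
have [|c c0 cE] := xn (fun i => act x (e i)); first by move=> i; exists (e i).
exists (\sum_i c 0 i *: e i).
  apply: contraNneq c0 => ce0; apply/eqP/rowP => i; rewrite mxE.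
  exact: (free_e _ (c 0)).
by rewrite linear_sumr -[RHS]cE; apply: eq_bigr => i _; rewrite linearZr_LR.
Qed.


(** * Diagonalizability on V and under the adjoint action *)

Definition diagonalizable (f : V -> V) : Prop :=
  forall u, lspan (eigenvectors f) u.

Lemma br_diagonalizable x : sp V x -> diagonalizable (act x) ->
  forall y, lspan (eigenvectors (br x)) y.
Proof.
move=> spx dx y; have sE := lspan_subspace (eigenvectors (br x)).
have [E0 EP] := sE.
elim/tens_ind: y => [v w||y z Ey Ez] //; last exact: subspaceD.
apply: (lspan_sub (U := [set v | lspan (eigenvectors (br x)) (v ⊗ w)])) (dx v).
  split=> [|a v1 v2 Ev1 Ev2] /=; first by rewrite linear0l.
  by rewrite linearPl; exact: EP.
move=> {}v [a va] /=.
apply: (lspan_sub (U := [set w | lspan (eigenvectors (br x)) (v ⊗ w)])) (dx w).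
  split=> [|b w1 w2 Ew1 Ew2] /=; first by rewrite linear0r.
  by rewrite linearPr; exact: EP.
by move=> {}w [b wb] /=; apply: sub_lspan; exists (a + b); exact: br_eigen.
Qed.

Lemma diagonalizable_of_ad x z : act x z = 0 -> z != 0 ->
  sp V `<=` lspan (eigenvectors (br x)) -> diagonalizable (act x).
Proof.
move=> xz z0 dx.
have sE := lspan_subspace (eigenvectors (act x)).
have Ez y : sp V y -> lspan (eigenvectors (act x)) (act y z).
  move=> /dx; move: y.
  apply: (lspan_sub (U := [set y | lspan (eigenvectors (act x)) (act y z)])).
    split=> [|a y y' Ey Ey'] /=; first by rewrite linear0l; case: sE.
    by rewrite linearPl; case: sE => _; apply.
  move=> y [a ya] /=; apply: sub_lspan; exists a.
  by have := act_br x y z; rewrite ya xz linear0r subr0 linearZl_LR.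
have [w wz] := omega_dual z0.
have zw : omega z (- w) = 1 by rewrite linearNr /= omega_skew opprK.
(* The symmetric tensor of [v] and [- w] sends [z] to [v] plus a multiple of [- w]. Taking [v] to be
   [- w] gives twice [- w], so [- w] lies in the span, and then so does every [v]. *)
have Ew : lspan (eigenvectors (act x)) (- w).
  have := Ez _ (Sym2_tens (A := setT) (v := - w) (w := - w) I I).
  rewrite act_sym zw -scalerDl => /(subspaceZ 2%:R^-1 sE).
  by rewrite scalerA mulVf ?scale1r.
move=> v; have := Ez _ (Sym2_tens (A := setT) (v := v) (w := - w) I I).
rewrite act_sym zw scale1r => /(subspaceB sE)/(_ (subspaceZ (omega z v) sE Ew)).
by rewrite addrK.
Qed.

(** Each eigenspace of [f] is stable under [g], so its vectors split into simultaneous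
    eigenvectors. *)
Lemma commuting_diagonalizable (f g : V -> V) (c : K) : linear f -> linear g ->
  (forall u, f (g u) = g (f u)) -> diagonalizable f -> diagonalizable g ->
  diagonalizable (fun u => f u + c *: g u).
Proof.
move=> fL gL fg df dg u.
apply: lspan_sub (df u); first exact: lspan_subspace.
move=> {}u [a ua].
have sEa : is_subspace [set v | f v = a *: v].
  split=> /= [|b v w va wa]; first by rewrite (lin0 fL) scaler0.
  by rewrite fL va wa scalerDr !scalerA mulrC.
have [|s [h [_ -> geig Ea]]] := eigen_decomposition gL sEa _ ua (dg u).
  by move=> v /= va; rewrite fg va (lin_scale gL).
rewrite big_seq; apply: subspace_sum; first exact: lspan_subspace.
move=> b bs; apply: sub_lspan; exists (a + c * b).
by rewrite (Ea b bs) geig scalerDl scalerA.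
Qed.

(** * Semisimplicity relative to an exhaustion; toral subalgebras *)

Section Exhaustion.
Variable G : nat -> set (V ⊗ V).
Hypothesis V_dim : countably_infinite_dim V.
Hypothesis G_exh : reductive_exhaustion br (sp V) G.

Lemma exhaustion_mono m n : (m <= n)%N -> G m `<=` G n.
Proof.
case: G_exh => _ Gm _ _ /subnK <-; elim: (n - m)%N => [|k IH] // x Gx.
by rewrite addSn; apply: Gm; exact: IH.
Qed.

(** Forward, [x] and any [y] of sp(V) lie in a common [G n], so [br x] is diagonalizable on sp(V).
    Backward, [G n] is stable under [br x] and inherits the decomposition of the whole tensor
    square. *)
Lemma semisimpleP x : sp V x -> semisimple br G x <-> diagonalizable (act x).
Proof.
case: G_exh => Glie _ _ GU spx; split=> [ssx|dx n Gx].
  have [z z0 xz] := act_kernel x V_dim; apply: (diagonalizable_of_ad xz z0) => y.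
  have [n _ Gx] : (\bigcup_n G n) x by rewrite GU.
  rewrite -GU => -[m _ Gy].
  have Gx' := exhaustion_mono (leq_maxl n m) Gx.
  have := ssx _ Gx' _ (exhaustion_mono (leq_maxr n m) Gy).
  apply: lspan_sub; first exact: lspan_subspace.
  by move=> w [_ w_eig]; exact: sub_lspan.
have [[sG brG] _ _] := Glie n.
move=> y Gy.
have [|s [g [_ -> geig Gg]]] :=
  eigen_decomposition (br_linear x) sG _ Gy (br_diagonalizable spx dx y).
  by move=> v Gv; exact: brG.
rewrite big_seq; apply: subspace_sum; first exact: lspan_subspace.
move=> a sa; apply: sub_lspan; split; first exact: Gg.
by exists a.
Qed.

(** For an eigenvector [g a] of [br x] in [t], the bracket of [g a] with [x] is a multiple of [g a],
    so bracketing twice with [g a] kills [x]. As [br (g a)] is diagonalizable, bracketing once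
    already does. *)
Lemma toral_abelian t : toral br (sp V) G t -> abelian_on br t.
Proof.
case=> [[st brt] tsp tss] x y tx ty.
have dt z : t z -> forall w, lspan (eigenvectors (br z)) w.
  move=> tz; apply: br_diagonalizable; first exact: tsp.
  by apply/semisimpleP; [exact: tsp|exact: tss].
have [|s [g [_ -> geig tg]]] :=
  eigen_decomposition (br_linear x) st _ ty (dt x tx y).
  by move=> v; exact: brt.
rewrite (lin_sum (br_linear x)) big_seq big1 // => a /tg tga.
rewrite brC (eigen_nilpotent (br_linear _)) ?oppr0 //; first exact: dt.
by rewrite (brC _ x) geig -scaleNr (lin_scale (br_linear _)) brxx scaler0.
Qed.

(** Adjoining [h] to [t] gives an abelian subalgebra whose elements are sums of commuting
    diagonalizable ones, hence a toral one. *)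
Lemma maximal_toral_mem t h : maximal_toral br (sp V) G t -> sp V h ->
  (forall y, t y -> br y h = 0) -> diagonalizable (act h) -> t h.
Proof.
move=> [tt tmax] sph th dh; have tab := toral_abelian tt.
have [[[t0 tP] brt] tsp tss] := tt.
have sps : is_subspace (sp V) := Sym2_subspace setT.
pose t' := [set x | exists2 y, t y & exists c, x = y + c *: h].
have t'P c x y : t' x -> t' y -> t' (c *: x + y).
  move=> [x1 tx1 [a ->]] [y1 ty1 [b ->]]; exists (c *: x1 + y1); first exact: tP.
  by exists (c * a + b); rewrite scalerDr addrACA scalerA scalerDl.
have t'0 : t' 0 by exists 0 => //; exists 0; rewrite scale0r addr0.
have <- : t' = t.
  apply: tmax; last by move=> y ty; exists y => //; exists 0; rewrite scale0r addr0.
  split.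
  - split=> // _ _ [x tx [a ->]] [y ty [b ->]].
    suff -> : br (x + a *: h) (y + b *: h) = 0 by [].
    rewrite [x + _]addrC [y + _]addrC br_linear_l /= !br_linear brxx (brC h y).
    by rewrite !th // tab // oppr0 !(scaler0, addr0).
  - move=> _ [y ty [c ->]]; apply: subspaceD => //; first exact: tsp.
    exact: subspaceZ.
  - move=> _ [y ty [c ->]]; apply/semisimpleP.
      by apply: subspaceD => //; [exact: tsp | exact: subspaceZ].
    have -> : act (y + c *: h) = (fun u => act y u + c *: act h u).
      by apply/funext => u; rewrite linearDl /= linearZl_LR.
    apply: commuting_diagonalizable => //.
    + exact: act_linear.
    + exact: act_linear.
    + by move=> u; apply: act_comm; exact: th.
    + by apply/semisimpleP; [exact: tsp | exact: tss].
by exists 0 => //; exists 1; rewrite scale1r add0r.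
Qed.

End Exhaustion.

(** * Weight vectors, hyperbolic pairs and the null space of [t] *)

Section MaximalToral.
Variable t : set (V ⊗ V).
Hypothesis t_subspace : is_subspace t.
Hypothesis t_sp : t `<=` sp V.
Hypothesis t_abelian : abelian_on br t.
Hypothesis t_diag : forall y, t y -> diagonalizable (act y).
Hypothesis t_max : forall h, sp V h -> (forall y, t y -> br y h = 0) ->
  diagonalizable (act h) -> t h.

Definition weight_vectors : set V :=
  [set v | forall y, t y -> exists a, act y v = a *: v].

Lemma range_subspace x : is_subspace (range (act x)).
Proof.
split=> [|a _ _ [u _ <-] [v _ <-]]; first by exists 0; rewrite ?linear0r.
by exists (a *: u + v); rewrite // linearPr.
Qed.

(** If some [y] in [t] is not scalar on [U], its eigenspaces in [U] are proper, and they are stable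
    under [t] because [t] is abelian; induction on dimension applies to each. *)
Lemma weight_decomposition n U : is_subspace U -> dim_le U n ->
  (forall y u, t y -> U u -> U (act y u)) -> U `<=` lspan (weight_vectors `&` U).
Proof.
elim: n U => [|n IH] U sU Un tU u Uu.
  by rewrite (dim_le0 Un Uu); case: (lspan_subspace (weight_vectors `&` U)).
case: (pselect (forall y, t y -> exists a, forall u, U u -> act y u = a *: u)).
  move=> Uw; apply: sub_lspan; split=> // y ty.
  by have [a aE] := Uw y ty; exists a; exact: aE.
move=> nUw; have [y ty yU] : exists2 y, t y &
    ~ exists a, forall u, U u -> act y u = a *: u.
  apply: contrapT => nE; apply: nUw => y ty; apply: contrapT => nEy.
  by apply: nE; exists y.
have [|s [g [_ -> geig Ug]]] :=
  eigen_decomposition (act_linear y) sU _ Uu (t_diag ty u).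
  by move=> v; exact: tU.
rewrite big_seq; apply: subspace_sum; first exact: lspan_subspace.
move=> a sa; pose Ua := U `&` [set v | act y v = a *: v].
have sUa : is_subspace Ua.
  split=> [|b v w [Uv va] [Uw wa]]; split.
  - by case: sU.
  - by rewrite /= linear0r scaler0.
  - by case: sU => _; apply.
  - by rewrite /= linearPr /= va wa scalerDr !scalerA mulrC.
have [v Uv nav] : exists2 v, U v & ~ Ua v.
  apply: contrapT => nE; apply: yU; exists a => v Uv.
  by apply: contrapT => nv; apply: nE; exists v => // -[].
have Uan : dim_le Ua n by apply: (dim_le_proper sUa _ Un Uv nav) => w [].
apply: (lspan_sub (lspan_subspace _) _ (IH Ua sUa Uan _ _ _)).
- by move=> w [ww [Uw _]]; apply: sub_lspan.
- move=> y' w ty' [Uw wa]; split; first exact: tU.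
  rewrite /= (act_comm (y := y')) ?wa; last exact: t_abelian.
  by rewrite linearZr_LR.
- by split; [exact: Ug | exact: geig].
Qed.

Lemma range_weight_decomposition y u : t y ->
  lspan (weight_vectors `&` range (act y)) (act y u).
Proof.
move=> ty; have [n yn] := act_dim_le y.
apply: (weight_decomposition (range_subspace y) yn); last by exists u.
move=> y' _ ty' [w _ <-]; exists (act y' w) => //.
by apply: act_comm; exact: t_abelian.
Qed.

(** Skewness of [t] forces [v] and [w] to have opposite weights, so their symmetric tensor commutes
    with [t]. It scales [v] by [omega v w] and [w] by the opposite, and kills the orthogonal
    complement of both. *)
Lemma hyperbolic_mem v w : weight_vectors v -> weight_vectors w ->
  omega v w != 0 -> t (v ⊗ w + w ⊗ v).
Proof.
move=> wv ww vw; have sph : sp V (v ⊗ w + w ⊗ v) by exact: Sym2_tens.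
apply: t_max => // [y ty|u].
  have [a va] := wv y ty; have [b wb] := ww y ty.
  have ab : a + b = 0.
    apply/eqP; move: (act_skew v w (t_sp ty)).
    rewrite va wb linearZl_LR linearZr_LR /= => /eqP.
    by rewrite -addr_eq0 -mulrDl mulf_eq0 (negPf vw) orbF.
  have spy := t_sp ty.
  rewrite -[v ⊗ w]scale1r br_linear (br_eigen spy va wb) (br_eigen spy wb va).
  by rewrite [b + a]addrC ab !scale0r scaler0 addr0.
have sE := lspan_subspace (eigenvectors (act (v ⊗ w + w ⊗ v))).
pose c := omega v w.
(* The parenthesized vector is the component of [u] orthogonal to [v] and [w]. *)
have -> : u = (u - (omega u w / c) *: v + (omega u v / c) *: w)
    + (omega u w / c) *: v - (omega u v / c) *: w.
  by rewrite addrAC addrK subrK.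
have wvE : omega w v = - c by exact: omega_skew.
apply: subspaceB => //; first apply: subspaceD => //.
- apply: sub_lspan; exists 0; rewrite act_sym scale0r.
  rewrite !(linearDl, linearBl, linearZl_LR) /= !linearNl !linearZl_LR /=.
  rewrite !omega_alt wvE -/c !mulr0 mulrN !divfK //.
  by rewrite addr0 subr0 !subrr !scale0r addr0.
- apply: subspaceZ => //; apply: sub_lspan; exists c.
  by rewrite act_sym omega_alt scale0r addr0.
- apply: subspaceZ => //; apply: sub_lspan; exists (- c).
  by rewrite act_sym omega_alt scale0r add0r wvE.
Qed.

Definition null_space : set V := [set v | forall y, t y -> act y v = 0].

Lemma generalized_zero_spaceE : generalized_zero_space omega t = null_space.
Proof.
apply/seteqP; split=> v /=; last by move=> v0; exists 1%N; split.
move=> [[|i] [// _ vi]] y ty; move: {vi}(vi y ty).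
elim: i => // i IH /= yy; apply: IH.
exact: (eigen_nilpotent (act_linear y) (t_diag ty _)).
Qed.

Lemma null_space_subspace : is_subspace null_space.
Proof.
split=> [y _|a u v u0 v0 y ty]; first by rewrite linear0r.
by rewrite linearPr /= u0 // v0 // scaler0 addr0.
Qed.

(** Otherwise the symmetric tensor of [v] and [w] lies in [t] and so kills [v], while it sends [v]
    to a nonzero multiple of itself. *)
Lemma null_space_isotropic v w : null_space v -> null_space w -> omega v w = 0.
Proof.
move=> v0 w0; apply: contrapT => /eqP vw.
have wt u : null_space u -> weight_vectors u.
  by move=> u0 y ty; exists 0; rewrite u0 ?scale0r.
have /v0/eqP := hyperbolic_mem (wt v v0) (wt w w0) vw.
rewrite act_sym omega_alt scale0r addr0 scaler_eq0 (negPf vw) /= => /eqP vE.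
by case/eqP: vw; rewrite vE linear0l.
Qed.

(** [x] preserves the eigenspace of the hyperbolic element for [c]. This is the line of [v]: pairing
    with [v] shows that there is no [w] component, as [c] differs from [- c]. *)
Lemma hyperbolic_eigen x v w : omega v w != 0 -> br x (v ⊗ w + w ⊗ v) = 0 ->
  exists e, act x v = e *: v.
Proof.
move=> vw xh; pose c := omega v w; have wvE : omega w v = - c by exact: omega_skew.
have := act_comm v xh; rewrite !act_sym omega_alt scale0r addr0 linearZr_LR /= -/c.
move=> E; have xv0 : omega (act x v) v = 0.
  have := congr1 (omega^~ v) E; rewrite /= linearDl !linearZl_LR /= omega_alt wvE.
  rewrite mulr0 add0r mulrN mulrC => /eqP; rewrite -addr_eq0 -mulr2n -mulr_natl.
  by rewrite !mulf_eq0 (negPf two_neq0) (negPf vw) orbF => /eqP.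
exists (c^-1 * omega (act x v) w); rewrite xv0 scale0r addr0 in E.
by rewrite -scalerA -E scalerA mulVf // scale1r.
Qed.

(** Since [x - s] commutes with [t], killing [t] V means mapping V into [null_space], which is the
    form that [Sym2_range] needs. Induction on the rank of [x]. *)
Lemma centralizer_reduction n x : sp V x -> (forall y, t y -> br x y = 0) ->
  dim_le (range (act x)) n ->
  exists2 s, t s & forall y u, t y -> act (x - s) (act y u) = 0.
Proof.
have [t0 tP] := t_subspace.
elim: n x => [|n IH] x spx xt xn.
  exists 0 => // y u ty; rewrite subr0; apply: (dim_le0 xn).
  by exists (act y u).
case: (pselect (forall y u, t y -> act x (act y u) = 0)) => [xt0|nxt0].
  by exists 0 => // y u ty; rewrite subr0 xt0.
have [y [ty [v0 xyv0]]] : exists y, t y /\ exists v0, act x (act y v0) <> 0.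
  apply: contrapT => nE; apply: nxt0 => y u ty; apply: contrapT => nyu.
  by apply: nE; exists y; split => //; exists u.
have spy := t_sp ty.
have [v [[wv [v1 _ v1E]] xv]] : exists v,
    (weight_vectors `&` range (act y)) v /\ act x v <> 0.
  apply: contrapT => nE; apply: xyv0.
  apply: (lspan_sub (U := [set v | act x v = 0])) (range_weight_decomposition v0 ty).
    split=> [|a u w /= u0 w0]; first by rewrite /= linear0r.
    by rewrite /= linearPr /= u0 w0 scaler0 addr0.
  by move=> v wv; apply: contrapT => xv; apply: nE; exists v.
have [l vl] := wv y ty.
(* As [v] is in the range of the diagonalizable [y], weight zero would force it to vanish. *)
have l0 : l != 0.
  apply: contra_notN xv => /eqP l0; rewrite l0 scale0r -v1E in vl.
  by rewrite -v1E (eigen_nilpotent (act_linear y) (t_diag ty _) vl) linear0r.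
(* If [v] were orthogonal to all weight vectors, it would be orthogonal to the range of [y]; but by
   skewness [omega v (act y u)] is [- l] times [omega v u], which is nonzero. *)
have [w [ww vw]] : exists w, weight_vectors w /\ omega v w != 0.
  have v_neq0 : v != 0 by apply: contra_notN xv => /eqP ->; rewrite linear0r.
  have [u uv] := omega_dual v_neq0.
  apply: contrapT => nE.
  suff : omega v (act y u) = 0.
    move/eqP; rewrite omega_skew act_skew // vl linearZr_LR /= uv mulr1 opprK.
    by rewrite (negPf l0).
  apply: (lspan_sub (U := [set w | omega v w = 0])) (range_weight_decomposition u ty).
    split=> [|a u1 u2 /= E1 E2]; first by rewrite /= linear0r.
    by rewrite /= linearPr /= E1 E2 mulr0 addr0.
  by move=> w [ww _]; apply: contrapT => /eqP vw; apply: nE; exists w.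
pose h := v ⊗ w + w ⊗ v; pose c := omega v w.
have th : t h by exact: hyperbolic_mem.
have wvE : omega w v = - c by exact: omega_skew.
have [e ve] := hyperbolic_eigen vw (xt h th).
have [f wf] : exists e, act x w = e *: w.
  by apply: (@hyperbolic_eigen x w v); rewrite ?wvE ?oppr_eq0 // addrC xt.
have fE : f = - e.
  apply/eqP; rewrite -addr_eq0; move/eqP: (act_skew v w spx).
  rewrite ve wf linearZl_LR linearZr_LR /= -addr_eq0 -mulrDl mulf_eq0 (negPf vw).
  by rewrite orbF addrC.
have e0 : e != 0 by apply: contra_notN xv => /eqP e0; rewrite ve e0 scale0r.
(* [x] has eigenvalues [e] and [- e] on [v] and [w], while [h] has [c] and [- c]; this multiple of
   [h] cancels both. *)
pose x' := x - (e / c) *: h.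
have x'E u : act x' u = act x u - (e / c) *: act h u.
  by rewrite linearBl /= linearZl_LR.
have spx' : sp V x'.
  have sps := Sym2_subspace setT.
  by apply: subspaceB => //; apply: subspaceZ => //; exact: t_sp.
have x't y' : t y' -> br x' y' = 0.
  move=> ty'; rewrite /x' addrC -scaleNr br_linear_l /= xt // t_abelian //.
  by rewrite scaler0 addr0.
have x'w : act x' w = 0.
  rewrite x'E wf fE act_sym omega_alt scale0r add0r wvE scalerA mulrN.
  by rewrite divfK // subrr.
have sx := range_subspace x.
have xv' : range (act x) v.
  by exists (e^-1 *: v) => //; rewrite linearZr_LR /= ve scalerA mulVf // scale1r.
have xw' : range (act x) w.
  exists (- e^-1 *: w) => //; rewrite linearZr_LR /= wf fE scalerA mulrNN mulVf //.
  by rewrite scale1r.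
(* The range of [x'] lies in that of [x] and is orthogonal to [w], as [x'] kills [w]; so it misses
   [v]. *)
have x'n : dim_le (range (act x')) n.
  apply: (dim_le_proper (range_subspace x') _ xn xv').
    move=> _ [u _ <-]; rewrite x'E act_sym; apply: subspaceB => //.
    by apply: subspaceZ => //; apply: subspaceD => //; exact: subspaceZ.
  move=> [u _ uv]; case/eqP: vw.
  by rewrite -uv act_skew // x'w linear0r oppr0.
have [s ts sE] := IH x' spx' x't x'n.
exists ((e / c) *: h + s); first exact: tP.
by move=> y' u ty'; rewrite opprD addrA; exact: sE.
Qed.

(** * Sym2 of the null space and the structure of the centralizer *)

Lemma Sym2_null_centralizes x y : Sym2 null_space x -> t y -> br x y = 0.
Proof.
move=> x0 ty; move: x x0; apply: Sym2_ind => [|a x x' x0 x'0|v w v0 w0].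
- exact: (lin0 (br_linear_l y)).
- by rewrite br_linear_l /= x0 x'0 scaler0 addr0.
rewrite brC -[v ⊗ w]scale1r br_linear !br_tens ?v0 ?w0 //; try exact: t_sp.
by rewrite !linear0l !linear0r !addr0 scaler0 oppr0.
Qed.

Lemma Sym2_null_act x u : Sym2 null_space x -> null_space (act x u).
Proof.
have [n0 nP] := null_space_subspace.
move: x; apply: Sym2_ind => [|a x y x0 y0|v w v0 w0].
- by rewrite linear0l.
- by rewrite linearPl; exact: nP.
rewrite act_sym; apply: (nP) => //.
exact: (subspaceZ (U := null_space)) null_space_subspace w0.
Qed.

(** Even the associative products vanish: by isotropy, elements of Sym2(V^0) kill V^0, which
    contains the factors of the others. *)
Lemma Sym2_null_abelian : abelian_on br (Sym2 null_space).
Proof.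
suff m0 x y : Sym2 null_space x -> Sym2 null_space y -> tmul omega x y = 0.
  by move=> x y xS yS; rewrite /tbracket !m0 // subrr.
move=> xS; move: x xS y; apply: Sym2_ind => [|a x x' x0 x'0|v w v0 w0] y yS.
- by rewrite linear0l.
- by rewrite linearPl /= x0 // x'0 // scaler0 addr0.
rewrite linearDl /= !tmul_tensl; try exact: (Sym2_sp yS).
suff yn u : null_space u -> act y u = 0 by rewrite !yn // !linear0r oppr0 addr0.
move=> u0; move: y yS; apply: Sym2_ind => [|a y y' y0 y'0|p q p0 q0].
- by rewrite linear0l.
- by rewrite linearPl /= y0 y'0 scaler0 addr0.
by rewrite act_sym !null_space_isotropic // !scale0r addr0.
Qed.

Lemma centralizer_maximal_toral : let z := centralizer br (sp V) t in
  [/\ direct_sum z t (Sym2 (generalized_zero_space omega t)),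
      lie_subalgebra br z & abelian_on br z].
Proof.
move=> z; rewrite generalized_zero_spaceE.
have [t0 tP] := t_subspace; have sS := Sym2_subspace null_space.
have sps : is_subspace (sp V) := Sym2_subspace setT.
have tz x : t x -> z x.
  by move=> tx; split=> [|y ty]; [exact: t_sp | exact: t_abelian].
have Sz x : Sym2 null_space x -> z x.
  move=> Sx; split=> [|y ty]; first exact: (Sym2_sp Sx).
  exact: Sym2_null_centralizes.
have zs : is_subspace z.
  split=> [|a x y [spx x0] [spy y0]]; first exact: tz.
  split; first by case: sps => _; apply.
  by move=> w tw; rewrite br_linear_l /= x0 // y0 // scaler0 addr0.
have zE : z = [set x + y | x in t & y in Sym2 null_space].
  apply/seteqP; split=> [x zx|_ [x tx [y Sy <-]]]; last first.
    by apply: subspaceD => //; [exact: tz | exact: Sz].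
  have [spx xt] := zx; have [n xn] := act_dim_le x.
  have [s ts sE] := centralizer_reduction spx xt xn.
  have [spn nt] : z (x - s) by apply: subspaceB => //; exact: tz.
  exists s => //; exists (x - s); last by rewrite addrC subrK.
  apply: (Sym2_range null_space_subspace spn) => u y ty.
  by rewrite -(act_comm u (nt y ty)) sE.
have z_ab : abelian_on br z.
  (* Only the Sym2(V^0) part of [x'] can contribute, since [x] centralizes [t]; against it, both
     parts of [x] bracket to zero. *)
  move=> x x' zx; rewrite zE => -[y ty [s Ss <-]].
  rewrite -[y]scale1r br_linear (proj2 zx y ty) scaler0 add0r.
  move: zx; rewrite zE => -[y' ty' [s' Ss' <-]].
  rewrite -[y']scale1r br_linear_l /= (Sym2_null_abelian Ss' Ss) addr0.
  by rewrite brC Sym2_null_centralizes // oppr0 scaler0.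
split=> //; last by split=> // x y zx zy; rewrite z_ab //; case: zs.
split=> //; apply/seteqP; split=> [x [tx Sx]|_ ->]; last by split=> //; case: sS.
apply: act_faithful; first exact: t_sp.
(* The image of [x] lies in [null_space], which [x] kills as an element of [t]. *)
move=> u; apply: (eigen_nilpotent (act_linear x) (t_diag tx u)).
exact: Sym2_null_act.
Qed.

End MaximalToral.

End Symplectic.

Theorem corollary4p6 (R : realType) (V : lmodType R[i])
    (omega : {skew_symmetric V}) (G : nat -> set (V ⊗ V)) (t : set (V ⊗ V)) :
  countably_infinite_dim V ->
  form_nondegenerate omega ->
  reductive_exhaustion (tbracket omega) (sp V) G ->
  maximal_toral (tbracket omega) (sp V) G t ->
  let z := centralizer (tbracket omega) (sp V) t in
  [/\ direct_sum z t (Sym2 (generalized_zero_space omega t)),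
      lie_subalgebra (tbracket omega) z
    & abelian_on (tbracket omega) z].
Proof.
move=> V_dim nondeg G_exh t_max.
have two_neq0 : 2%:R != 0 :> R[i] by rewrite pnatr_eq0.
have [t_toral _] := t_max; have [[t_sub _] t_sp t_ss] := t_toral.
apply: centralizer_maximal_toral => //.
- exact: (toral_abelian two_neq0 nondeg V_dim G_exh).
- move=> y ty; apply/(semisimpleP two_neq0 nondeg V_dim G_exh); first exact: t_sp.
  exact: t_ss.
- by move=> h; exact: (maximal_toral_mem two_neq0 nondeg V_dim G_exh t_max).
Qed.
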